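(* Let $I,J,M,N\subseteq\{1,\dots,n\}$ with $|I|=|J|$ and $|M|=|N|$. Then, for the standard Poisson bracket on $\mathcal{O}(M_n(k))$, $$\begin{aligned}\bigl\{[I|J],[M|N]\bigr\}&=\bigl(|J\cap N|-|I\cap M|\bigr)[I|J][M|N]\\&\quad+2\sum_{\substack{j\in J\setminus N\\ p\in N\setminus J\\ j<p}}(-1)^{|(J\Delta N)\cap(j,p)|}\,[I\,|\,(J\cup\{p\})\setminus\{j\}]\,[M\,|\,(N\cup\{j\})\setminus\{p\}]\\&\quad-2\sum_{\substack{i\in I\setminus M\\ m\in M\setminus I\\ i>m}}(-1)^{|(I\Delta M)\cap(m,i)|}\,[(I\cup\{m\})\setminus\{i\}\,|\,J]\,[(M\cup\{i\})\setminus\{m\}\,|\,N].\end{aligned}$$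
   Context: Let $k$ be a field (of any characteristic) and $n$ a positive integer. $\mathcal{O}(M_n(k))$ is the commutative polynomial ring over $k$ in indeterminates $x_{ij}$, $i,j=1,\dots,n$. A Poisson bracket on a commutative $k$-algebra $B$ is a $k$-bilinear map $\{-,-\}:B\times B\to B$ making $B$ a Lie algebra and such that $\{b,-\}$ is a derivation for each $b\in B$. The standard Poisson bracket on $\mathcal{O}(M_n(k))$ is the unique Poisson bracket with $\{x_{ij},x_{lj}\}=x_{ij}x_{lj}$ for $i<l$; $\{x_{ij},x_{im}\}=x_{ij}x_{im}$ for $j<m$; $\{x_{ij},x_{lm}\}=0$ for $i<l$, $j>m$; $\{x_{ij},x_{lm}\}=2x_{im}x_{lj}$ for $i<l$, $j<m$. For $I,J\subseteq\{1,\dots,n\}$ with $|I|=|J|$, $[I|J]$ denotes the classical minor: the determinant of the submatrix of $(x_{ij})$ with rows $I$ and columns $J$ (listed in ascending order); $[\varnothing|\varnothing]=1$. $\Delta$ is symmetric difference of sets, and $(a,b)$ denotes the open interval of integers strictly between $a$ and $b$. *)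

(* Defs.v *)
From mathcomp Require Import all_boot all_order all_algebra.
From mathcomp Require Import mpoly ring zify.

Set Implicit Arguments.
Unset Strict Implicit.
Unset Printing Implicit Defensive.

Import GRing.Theory.
Local Open Scope ring_scope.

(* The alternating law is [br b b = 0] rather than antisymmetry, which is
   weaker in characteristic 2. *)
Record is_poisson_bracket (k : fieldType) (B : comAlgType k)
    (br : B -> B -> B) : Prop := IsPoissonBracket {
  poisson_linearl : forall c : B, linear (fun b => br b c);
  poisson_linearr : forall b : B, linear (br b);
  poisson_alt : forall b : B, br b b = 0;
  poisson_jacobi : forall a b c : B,
    br a (br b c) + br b (br c a) + br c (br a b) = 0;
  poisson_leibniz : forall b c d : B,
    br b (c * d) = br b c * d + c * br b d
}.

Notation OMn k n := {mpoly k[(n * n)%N]}.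

(* The indeterminate x_ij is numbered by the bijection
   [mxvec_index : 'I_n -> 'I_n -> 'I_(n * n)]. *)
Definition gen_mx (k : fieldType) (n : nat) : 'M[OMn k n]_n :=
  \matrix_(i, j) 'X_(mxvec_index i j).

Record is_standard_poisson (k : fieldType) (n : nat)
    (br : OMn k n -> OMn k n -> OMn k n) : Prop := IsStandardPoisson {
  standard_is_poisson : is_poisson_bracket br;
  standard_col : forall i l j : 'I_n, (i < l)%N ->
    br (gen_mx k n i j) (gen_mx k n l j) = gen_mx k n i j * gen_mx k n l j;
  standard_row : forall i j m : 'I_n, (j < m)%N ->
    br (gen_mx k n i j) (gen_mx k n i m) = gen_mx k n i j * gen_mx k n i m;
  standard_anti : forall i l j m : 'I_n, (i < l)%N -> (m < j)%N ->
    br (gen_mx k n i j) (gen_mx k n l m) = 0;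
  standard_diag : forall i l j m : 'I_n, (i < l)%N -> (j < m)%N ->
    br (gen_mx k n i j) (gen_mx k n l m)
      = 2%:R * gen_mx k n i m * gen_mx k n l j
}.

(* [enum I] and [enum J] are in ascending order.  Only used for
   #|I| = #|J|, in which case the default value of [nth] is never reached. *)
Definition set_minor (R : comNzRingType) (n : nat) (A : 'M[R]_n)
    (I J : {set 'I_n}) : R :=
  \det (\matrix_(a < #|I|, b < #|I|)
          A (enum_val a) (nth (enum_val a) (enum J) b)).

Definition minor (k : fieldType) (n : nat) (I J : {set 'I_n}) : OMn k n :=
  set_minor (gen_mx k n) I J.

Definition symdiff (T : finType) (A B : {set T}) : {set T} :=
  (A :\: B) :|: (B :\: A).

Definition open_itv (n : nat) (a b : 'I_n) : {set 'I_n} :=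
  [set q : 'I_n | (a < q < b)%N].

(* The standard Poisson bracket exists and is unique, so that a statement
   about every [br] with [is_standard_poisson br] is about that bracket. *)

Lemma mpoly_alg_ind (k : fieldType) (N : nat) (Q : {mpoly k[N]} -> Prop) :
  Q 1 -> (forall c f, Q f -> Q (c *: f)) ->
  (forall f g, Q f -> Q g -> Q (f + g)) ->
  (forall f g, Q f -> Q g -> Q (f * g)) ->
  (forall i, Q 'X_i) -> forall f, Q f.
Proof.
move=> Q1 QZ QD QM QX; apply: mpolyind => [|c m p _ _ Qp].
  by rewrite -(scale0r 1); apply: QZ.
apply: QD => //; apply: QZ; rewrite mpolyXE_id.
apply: (big_ind Q) => // i _.
by elim: (m i) => [//|e IH]; rewrite exprS; apply: QM.
Qed.

Lemma derivation_eq0 (k : fieldType) (N : nat)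
    (D : {mpoly k[N]} -> {mpoly k[N]}) :
  linear D -> (forall f g, D (f * g) = D f * g + f * D g) ->
  (forall i, D 'X_i = 0) -> forall f, D f = 0.
Proof.
move=> linD leibD genD.
have D1 : D 1 = 0.
  by have := leibD 1 1; rewrite !mulr1 mul1r -[LHS]addr0 => /addrI.
have DD f g : D (f + g) = D f + D g.
  by have := linD 1 f g; rewrite !scale1r.
have D0 : D 0 = 0 by have := DD 0 0; rewrite addr0 -[LHS]addr0 => /addrI.
apply: mpoly_alg_ind => // [c f Df|f g Df Dg|f g Df Dg].
- by rewrite -[c *: f]addr0 linD Df D0 scaler0 addr0.
- by rewrite DD Df Dg addr0.
- by rewrite leibD Df Dg mul0r mulr0 addr0.
Qed.

Lemma poisson_anti (k : fieldType) (B : comAlgType k) (br : B -> B -> B) :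
  is_poisson_bracket br -> forall f g, br f g = - br g f.
Proof.
case=> linl linr alt _ _ f g; apply/eqP; rewrite -addr_eq0; apply/eqP.
have linl1 a b c : br (a + b) c = br a c + br b c.
  by have := linl c 1 a b; rewrite !scale1r.
have linr1 a b c : br c (a + b) = br c a + br c b.
  by have := linr c 1 a b; rewrite !scale1r.
by have := alt (f + g); rewrite linl1 !linr1 !alt add0r addr0.
Qed.

Section JacobiIdentities.
Variables (k : fieldType) (B : comAlgType k) (br : B -> B -> B).
Hypothesis br_linl : forall g, linear (fun f => br f g).
Hypothesis br_linr : forall f, linear (br f).
Hypothesis br_anti : forall f g, br f g = - br g f.
Hypothesis br_leib : forall f g h, br f (g * h) = br f g * h + g * br f h.

Let brD f g h : br f (g + h) = br f g + br f h.
Proof. by have := br_linr f 1 g h; rewrite !scale1r. Qed.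

Let br0 f : br f 0 = 0.
Proof. by have := brD f 0 0; rewrite addr0 -[LHS]addr0 => /addrI. Qed.

Let brN f g : br f (- g) = - br f g.
Proof. by apply/eqP; rewrite -addr_eq0 addrC -brD subrr br0. Qed.

Let br1 f : br f 1 = 0.
Proof.
by have := br_leib f 1 1; rewrite !mulr1 mul1r -[LHS]addr0 => /addrI.
Qed.

Let brnat f c : br f c%:R = 0.
Proof. by elim: c => [|c IH]; rewrite ?br0 // -natr1 brD IH br1 addr0. Qed.

Definition jacobiator f g h := br f (br g h) + br g (br h f) + br h (br f g).

Lemma jacobiatorC f g h : jacobiator f g h = jacobiator g h f.
Proof. by rewrite /jacobiator -addrA addrC. Qed.

Lemma jacobiator_linl g h : linear (fun f => jacobiator f g h).
Proof.
move=> c f f'; rewrite /jacobiator.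
rewrite (br_linl (br g h) c f) (br_linr h c f) (br_linl g c f).
rewrite (br_linr g) (br_linr h) !scalerDr.
have add3 (p q r p' q' r' : B) :
  (p + p') + (q + q') + (r + r') = (p + q + r) + (p' + q' + r') by ring.
exact: add3.
Qed.

Lemma jacobiator_leibl g h f f' :
  jacobiator (f * f') g h = jacobiator f g h * f' + f * jacobiator f' g h.
Proof.
rewrite /jacobiator (br_anti _ (br g h)) (br_anti (f * f') g) brN !br_leib !brD.
rewrite !br_leib (br_anti f (br g h)) (br_anti f' (br g h)).
by rewrite (br_anti f g) (br_anti f' g) !brN; ring.
Qed.

Lemma jacobiator_gen (n : nat) (x : 'I_n -> 'I_n -> B)
    (sg := fun a b : 'I_n => (a < b)%N%:R - (b < a)%N%:R : B) :
  (forall i j l m, br (x i j) (x l m) = (sg i l + sg j m) * x i m * x l j) ->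
  forall i1 j1 i2 j2 i3 j3, jacobiator (x i1 j1) (x i2 j2) (x i3 j3) = 0.
Proof.
move=> br_gen i1 j1 i2 j2 i3 j3.
have br_sg f a b : br f (sg a b) = 0 by rewrite brD brN !brnat subrr.
have sgC a b : sg b a = - sg a b by rewrite /sg opprB.
pose e a b c := sg a b * sg b c + sg b c * sg c a + sg c a * sg a b.
have eE a b c : e a b c = - (~~ ((a == b) && (b == c)))%:R.
  rewrite /e /sg -!val_eqE /=.
  have [?|?|?] := ltngtP a b; have [?|?|?] := ltngtP b c;
    have [?|?|?] := ltngtP a c; rewrite ?ltnn /=; first [lia | ring].
pose A := x i1 j3 * x i2 j1 * x i3 j2.
pose A' := x i1 j2 * x i2 j3 * x i3 j1.
have -> : jacobiator (x i1 j1) (x i2 j2) (x i3 j3)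
    = (e i1 i2 i3 - e j1 j2 j3) * (A - A').
  rewrite /jacobiator !(br_gen, br_leib, brD, br_sg) /e /A /A'.
  rewrite (sgC i1 i2) (sgC i2 i3) (sgC i1 i3) (sgC j1 j2) (sgC j2 j3).
  by rewrite (sgC j1 j3); ring.
rewrite !eE /A /A'; case: andP => [[/eqP<- /eqP<-]|_].
  by ring.
case: andP => [[/eqP<- /eqP<-]|_]; by ring.
Qed.

End JacobiIdentities.

Section Existence.
Variables (k : fieldType) (n : nat).
Local Notation P := (OMn k n).
Local Notation x := (gen_mx k n).

Let sg (a b : 'I_n) : P := (a < b)%N%:R - (b < a)%N%:R.
Let bgen (a b : 'I_n * 'I_n) : P :=
  (sg a.1 b.1 + sg a.2 b.2) * x a.1 b.2 * x b.1 a.2.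
Let ix (a : 'I_n * 'I_n) : 'I_(n * n) := mxvec_index a.1 a.2.

Definition standard_bracket (f g : P) : P :=
  \sum_a \sum_b f^`M(ix a) * g^`M(ix b) * bgen a b.
Local Notation br := standard_bracket.

Let ix_inj : injective ix.
Proof. by case=> [a b] [c d] /cast_ord_inj/enum_rank_inj. Qed.

Let mderiv_gen a b : (x a.1 a.2)^`M(ix b) = (a == b)%:R :> P.
Proof.
rewrite mxE mderivX mnm1E -/(ix a) (inj_eq ix_inj).
case: eqP => [->|_]; last by rewrite scale0r.
by rewrite scale1r -mpolyX0; congr 'X_[_]; apply/mnmP => i; rewrite !mnmE subnn.
Qed.

Let br_anti f g : br f g = - br g f.
Proof.
rewrite /br exchange_big /= -sumrN; apply: eq_bigr => b _.
rewrite -sumrN; apply: eq_bigr => a _.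
by rewrite /bgen /sg; ring.
Qed.

Let br_linr f : linear (br f).
Proof.
move=> c g h; rewrite /br scaler_sumr -big_split; apply: eq_bigr => a _ /=.
rewrite scaler_sumr -big_split; apply: eq_bigr => b _ /=.
by rewrite linearP /= mulrDr mulrDl -scalerAr -scalerAl.
Qed.

Let br_linl g : linear (fun f => br f g).
Proof.
by move=> c f h; rewrite br_anti br_linr opprD -scalerN -!br_anti.
Qed.

Let br_leib f g h : br f (g * h) = br f g * h + g * br f h.
Proof.
rewrite /br mulr_suml mulr_sumr -big_split; apply: eq_bigr => a _ /=.
rewrite mulr_suml mulr_sumr -big_split; apply: eq_bigr => b _ /=.
by rewrite mderivM; ring.
Qed.

Let br_leibl f g h : br (g * h) f = br g f * h + g * br h f.
Proof. by rewrite br_anti br_leib opprD -mulNr -mulrN -!br_anti. Qed.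

Let brD f g h : br f (g + h) = br f g + br f h.
Proof. by have := br_linr f 1 g h; rewrite !scale1r. Qed.

Let brDl f g h : br (g + h) f = br g f + br h f.
Proof. by have := br_linl f 1 g h; rewrite !scale1r. Qed.

Let br0 f : br f 0 = 0.
Proof. by have := brD f 0 0; rewrite addr0 -[LHS]addr0 => /addrI. Qed.

Let brN f g : br f (- g) = - br f g.
Proof. by apply/eqP; rewrite -addr_eq0 addrC -brD subrr br0. Qed.

Let br_gen i j l m : br (x i j) (x l m) = (sg i l + sg j m) * x i m * x l j.
Proof.
rewrite /br (bigD1 (i, j)) //= [X in _ + X]big1 ?addr0; last first.
  move=> a ne; apply: big1 => b _.
  by rewrite (mderiv_gen (i, j)) eq_sym (negbTE ne) !mul0r.
rewrite (bigD1 (l, m)) //= [X in _ + X]big1 ?addr0; last first.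
  move=> b ne.
  by rewrite (mderiv_gen (l, m)) [_ == b]eq_sym (negbTE ne) mulr0 mul0r.
by rewrite (mderiv_gen (i, j)) (mderiv_gen (l, m)) !eqxx !mul1r.
Qed.

Local Notation jac := (jacobiator br).

Let br_alt f : br f f = 0.
Proof.
move: f; apply: mpoly_alg_ind => [|c f ff|f g ff gg|f g ff gg|u].
- by have := br_leib 1 1 1; rewrite !mulr1 mul1r -[LHS]addr0 => /addrI.
- have brZ h : br h (c *: f) = c *: br h f.
    by have := br_linr h c f 0; rewrite br0 !addr0.
  by rewrite brZ br_anti brZ ff scaler0 oppr0 scaler0.
- by rewrite brD !brDl ff gg add0r addr0 (br_anti g f) addNr.
- by rewrite br_leib !br_leibl ff gg (br_anti g f); ring.
- case/mxvec_indexP: u => i j; have := br_gen i j i j.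
  by rewrite /sg ltnn subrr ltnn subrr addr0 !mul0r mxE.
Qed.

Let jac_linl g h : linear (fun f => jac f g h).
Proof. exact: (jacobiator_linl br_linl br_linr). Qed.

Let jac_leibl g h f f' : jac (f * f') g h = jac f g h * f' + f * jac f' g h.
Proof. exact: (jacobiator_leibl br_linr br_anti br_leib). Qed.

Let br_jac f g h : jac f g h = 0.
Proof.
apply: (derivation_eq0 (@jac_linl g h) (@jac_leibl g h)) => u.
rewrite jacobiatorC; apply: (derivation_eq0 (@jac_linl h _) (@jac_leibl h _)) => v.
rewrite jacobiatorC; apply: (derivation_eq0 (@jac_linl _ _) (@jac_leibl _ _)) => w.
case/mxvec_indexP: u => i j; case/mxvec_indexP: v => i' j'.
case/mxvec_indexP: w => i'' j''.
by have := jacobiator_gen br_linr br_leib br_gen i'' j'' i j i' j'; rewrite !mxE.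
Qed.

Lemma standard_bracketP : is_standard_poisson standard_bracket.
Proof.
split.
- split; [exact: br_linl | exact: br_linr | exact: br_alt | exact: br_jac |].
  exact: br_leib.
- by move=> i l j lt_il; rewrite br_gen /sg lt_il ltnn ltnNge ltnW //=; ring.
- by move=> i j m lt_jm; rewrite br_gen /sg lt_jm !ltnn ltnNge ltnW //=; ring.
- move=> i l j m lt_il lt_mj; rewrite br_gen /sg lt_il lt_mj.
  by rewrite ltnNge ltnW //= ltnNge ltnW //=; ring.
- move=> i l j m lt_il lt_jm; rewrite br_gen /sg lt_il lt_jm.
  by rewrite ltnNge ltnW //= ltnNge ltnW //=; ring.
Qed.

End Existence.

Lemma standard_poisson_unique (k : fieldType) (n : nat)
    (br br' : OMn k n -> OMn k n -> OMn k n) :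
  is_standard_poisson br -> is_standard_poisson br' ->
  forall f g, br f g = br' f g.
Proof.
move=> [pb col row anti diag] [pb' col' row' anti' diag'].
have brC := poisson_anti pb; have brC' := poisson_anti pb'.
have gen i j l m : br (gen_mx k n i j) (gen_mx k n l m)
                 = br' (gen_mx k n i j) (gen_mx k n l m).
  wlog le_il : i j l m / (i <= l)%N.
    move=> W; case/orP: (leq_total i l) => [|le]; first exact: W.
    by rewrite brC brC' W.
  have [lt_il|?|/val_inj <-] := ltngtP i l; [|lia|].
    have [?|?|/val_inj <-] := ltngtP j m.
    - by rewrite diag ?diag'.
    - by rewrite anti ?anti'.
    - by rewrite col ?col'.
  have [?|?|/val_inj <-] := ltngtP j m.
  - by rewrite row ?row'.
  - by rewrite brC brC' row ?row'.
  - by rewrite (poisson_alt pb) (poisson_alt pb').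
have diff_lin (b b' : OMn k n -> OMn k n) : linear b -> linear b' ->
    linear (fun f => b f - b' f).
  by move=> lb lb' c f g; rewrite lb lb' scalerBr opprD addrACA.
have diff_leib f : forall g h, br f (g * h) - br' f (g * h)
    = (br f g - br' f g) * h + g * (br f h - br' f h).
  move=> g h; rewrite (poisson_leibniz pb) (poisson_leibniz pb'); ring.
have eq_gen f i j : br f (gen_mx k n i j) = br' f (gen_mx k n i j).
  rewrite brC brC'; congr (- _); apply/eqP; rewrite -subr_eq0; apply/eqP.
  apply: (derivation_eq0 (diff_lin _ _ (poisson_linearr pb _)
    (poisson_linearr pb' _)) (diff_leib _)) => u.
  case/mxvec_indexP: u => l m.
  by apply/eqP; rewrite subr_eq0; have := gen i j l m; rewrite !mxE => ->.
move=> f g; apply/eqP; rewrite -subr_eq0; apply/eqP.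
apply: (derivation_eq0 (diff_lin _ _ (poisson_linearr pb f)
  (poisson_linearr pb' f)) (diff_leib f)) => u.
case/mxvec_indexP: u => l m.
by apply/eqP; rewrite subr_eq0; have := eq_gen f l m; rewrite !mxE => ->.
Qed.

(* Main.v *)
(* Both arguments of the bracket are differentiated once, and the coefficient
   [sg i l + sg j m] of [{x_ij, x_lm}] splits the bracket as the sum of
   [sg j m * C_jm f * C_mj g] over column pairs plus the sum of
   [sg i l * R_il f * R_li g] over row pairs, where [C_jm] (resp. [R_il]) is the
   derivation replacing column j by m (resp. row i by l).  With all weights
   equal to 1 the two sums coincide, so one may use the weights [1 + sg j m]
   and [-(1 - sg i l)] instead.  On a minor such a derivation replaces one
   index; the diagonal terms count the common indices, and the sign is the
   parity of the number of indices that the new one has to cross. *)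
Require Import Defs.
From mathcomp Require Import all_boot all_order all_algebra.
From mathcomp Require Import mpoly.
From mathcomp Require Import perm ring zify.

Import GRing.Theory.
Local Open Scope ring_scope.

(** * Positions of indices in ascending enumerations *)

Lemma card_sum_mem (T : finType) (A : {set T}) :
  #|A| = (\sum_(q : T) (q \in A : nat))%N.
Proof. by rewrite -sum1_card big_mkcond; apply: eq_bigr => q _; case: ifP. Qed.

Lemma sorted_enum_ord_set (n : nat) (J : {set 'I_n}) :
  sorted (relpre val ltn) (enum J).
Proof.
rewrite /enum_mem -enumT; apply: sorted_filter.
  by move=> ? ? ?; apply: ltn_trans.
by rewrite -sorted_map val_enum_ord iota_ltn_sorted.
Qed.

(** In an ascending list the position of [j] is the number of smaller members; every sign exponent
    below originates in this count. *)
Lemma enum_ord_set_split (n : nat) (J : {set 'I_n}) (j : 'I_n) : j \in J ->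
  exists s1 s2, [/\ enum J = s1 ++ j :: s2, enum (J :\ j) = s1 ++ s2
    & size s1 = #|[set q in J | (q < j)%N]|].
Proof.
move=> jJ; have jE : j \in enum J by rewrite mem_enum.
have lt_tr : transitive (relpre (val : 'I_n -> nat) ltn).
  by move=> ? ? ?; apply: ltn_trans.
have srt := sorted_enum_ord_set n J; have uniqJ := enum_uniq J.
have enumD1 : enum (J :\ j) = filter (predC1 j) (enum J).
  by rewrite /enum_mem -filter_predI; apply: eq_filter => q; rewrite /= !inE.
have cardlt : #|[set q in J | (q < j)%N]|
    = count (fun q : 'I_n => (q < j)%N) (enum J).
  rewrite cardE -size_filter /enum_mem -filter_predI; congr size.
  by apply: eq_filter => q; rewrite /= !inE andbC.
rewrite enumD1 cardlt; move: srt uniqJ; case/splitPr: jE => s1 s2.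
rewrite sorted_pairwise // pairwise_cat /= => /and3P[/allrelP lt12 _ /andP[/allP lt2 _]].
have lt1 q : q \in s1 -> (q < j)%N.
  by move=> qs1; apply: (lt12 q j) => //; rewrite mem_head.
move=> _; exists s1, s2; split=> //.
  rewrite filter_cat /= eqxx /=.
  congr (_ ++ _); apply/all_filterP/allP => q qs.
    by apply: contraTneq (lt1 q qs) => ->; rewrite ltnn.
  by apply: contraTneq (lt2 q qs) => ->; rewrite /= ltnn.
rewrite count_cat /= ltnn; have : all (fun q : 'I_n => (q < j)%N) s1 by apply/allP.
rewrite all_count => /eqP->; rewrite (@eq_in_count _ _ pred0) ?count_pred0 ?addn0 // => q qs.
by have /= := lt2 q qs; case: ltngtP.
Qed.

(** * Derivations of products and determinants *)

Section Derivations.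
Variables (R : comNzRingType) (D : R -> R).
Hypothesis D_add : {morph D : f g / f + g}.
Hypothesis D_mul : forall f g, D (f * g) = D f * g + f * D g.

Lemma derivation0 : D 0 = 0.
Proof. by have := D_add 0 0; rewrite addr0 -[LHS]addr0 => /addrI. Qed.

Lemma derivation1 : D 1 = 0.
Proof. by have := D_mul 1 1; rewrite !mulr1 mul1r -[LHS]addr0 => /addrI. Qed.

Lemma derivation_sign e : D ((-1) ^+ e) = 0.
Proof.
have DN1 : D (-1) = 0.
  by have := D_add 1 (-1); rewrite subrr derivation0 derivation1 add0r.
by elim: e => [|e IH]; rewrite ?derivation1 // exprS D_mul DN1 IH mul0r mulr0 addr0.
Qed.

Lemma derivation_prod p (F : 'I_p -> R) :
  D (\prod_a F a) = \sum_c \prod_a (if a == c then D (F a) else F a).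
Proof.
elim: p F => [|p IH] F; first by rewrite !big_ord0 derivation1.
rewrite big_ord_recl D_mul IH [RHS]big_ord_recl; congr (_ + _).
  by rewrite big_ord_recl eqxx; congr (_ * _); apply: eq_bigr.
rewrite mulr_sumr; apply: eq_bigr => c _.
rewrite [RHS]big_ord_recl; congr (_ * _).
Qed.

Lemma derivation_det p (A : 'M[R]_p) :
  D (\det A)
    = \sum_c \det (\matrix_(a, b) if b == c then D (A a b) else A a b).
Proof.
rewrite /determinant (big_morph D D_add derivation0) exchange_big /=.
apply: eq_bigr => s _; rewrite D_mul derivation_sign mul0r add0r.
(* The Leibniz rule differentiates one row [c] of the product for [s]; reindexing by [s] names that
   factor by its column [s c] instead, which does not depend on [s] after renaming. *)
rewrite derivation_prod mulr_sumr [RHS](reindex_inj (@perm_inj _ s)) /=.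
apply: eq_bigr => c _; congr (_ * _); apply: eq_bigr => a _.
by rewrite mxE (inj_eq perm_inj).
Qed.

End Derivations.

(** * Replacing column indices in a minor *)

Section ColumnLists.
Variables (R : comNzRingType) (n : nat) (A : 'M[R]_n) (I : {set 'I_n}).

(** Columns come as a list because replacing an index breaks the ascending order and may create
    repetitions. The lists used have length [#|I|], so the default of [nth] is never reached. *)
Definition seq_minor (s : seq 'I_n) : R :=
  \det (\matrix_(a < #|I|, b < #|I|)
          A (enum_val a) (nth (enum_val a) s b)).

Lemma det_zero_col p (B : 'M[R]_p) c : (forall a, B a c = 0) -> \det B = 0.
Proof.
by move=> B0; rewrite (expand_det_col B c) big1 // => a _; rewrite B0 mul0r.
Qed.

(** Expand both determinants along the column of [j]: deleting it leaves the columns [s1 ++ s2]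
    either way, and only the cofactor signs differ, by the position [size s1]. *)
Lemma seq_minor_rot s1 j s2 : size (s1 ++ j :: s2) = #|I| ->
  seq_minor (s1 ++ j :: s2) = (-1) ^+ size s1 * seq_minor (j :: s1 ++ s2).
Proof.
rewrite /seq_minor size_cat /= addnS => szs.
have lt0 : (0 < #|I|)%N by rewrite -szs.
have lt1 : (size s1 < #|I|)%N by rewrite -szs ltnS leq_addr.
rewrite (expand_det_col _ (Ordinal lt1)) (expand_det_col _ (Ordinal lt0)).
rewrite mulr_sumr; apply: eq_bigr => a _.
rewrite /cofactor !mxE /= nth_cat ltnn subnn /= addn0.
set B := row' a _; set B' := row' a _.
suff -> : B = B' by rewrite exprD; ring.
apply/matrixP => u v; rewrite !mxE /= !nth_cat /bump.
rewrite add0n; have [le|gt] := leqP (size s1) v.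
  by rewrite add1n subSn //= ltnNge leqW.
by rewrite add0n gt.
Qed.

Lemma seq_minor_dup m s : (size s).+1 = #|I| -> m \in s -> seq_minor (m :: s) = 0.
Proof.
move=> szs ms.
have lt0 : (0 < #|I|)%N by rewrite -szs.
have lt1 : ((index m s).+1 < #|I|)%N by rewrite -szs ltnS index_mem.
rewrite /seq_minor -det_tr.
apply: (@determinant_alternate _ _ _ (Ordinal lt0) (Ordinal lt1)) => // a.
by rewrite !mxE /= nth_index.
Qed.

(** With the distinguished index in front, minors on [J] and on [J] with [j] exchanged for [m] share
    the tail [enum (J :\ j)] and can be compared. *)
Lemma set_minor_head (J : {set 'I_n}) (j : 'I_n) : #|I| = #|J| -> j \in J ->
  set_minor A I J
    = (-1) ^+ #|[set q in J | (q < j)%N]| * seq_minor (j :: enum (J :\ j)).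
Proof.
move=> cIJ jJ; have [s1 [s2 [eJ -> <-]]] := enum_ord_set_split n J j jJ.
by rewrite -seq_minor_rot -eJ // -cardE cIJ.
Qed.

Section Replacement.
Variables (D : R -> R) (j m : 'I_n).
Hypothesis D_add : {morph D : f g / f + g}.
Hypothesis D_mul : forall f g, D (f * g) = D f * g + f * D g.
Hypothesis D_gen : forall a b, D (A a b) = if b == j then A a m else 0.

Lemma derivation_set_minor0 (J : {set 'I_n}) :
  #|I| = #|J| -> j \notin J -> D (set_minor A I J) = 0.
Proof.
move=> cIJ jJ; rewrite derivation_det // big1 // => c _.
apply: (@det_zero_col _ _ c) => a; rewrite !mxE eqxx D_gen.
case: eqP => // def_j; case/negP: jJ; rewrite -mem_enum -def_j mem_nth //.
by rewrite -cardE -cIJ.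
Qed.

(** Of the summands of [derivation_det], only the one at the position of [j] has no zero column.
    There [m] takes the place of [j], and moving it to the front gives the sign. *)
Lemma derivation_set_minor (J : {set 'I_n}) : #|I| = #|J| -> j \in J ->
  D (set_minor A I J)
    = (-1) ^+ #|[set q in J | (q < j)%N]| * seq_minor (m :: enum (J :\ j)).
Proof.
move=> cIJ jJ; have [s1 [s2 [eJ -> <-]]] := enum_ord_set_split n J j jJ.
have szJ : size (s1 ++ j :: s2) = #|I| by rewrite -eJ -cardE.
have lt1 : (size s1 < #|I|)%N by rewrite -szJ size_cat /= addnS ltnS leq_addr.
rewrite -seq_minor_rot; last by rewrite -szJ !size_cat.
rewrite derivation_det // (bigD1 (Ordinal lt1)) //= big1 ?addr0; last first.
  move=> c ne; apply: (@det_zero_col _ _ c) => a; rewrite !mxE eqxx D_gen.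
  case: eqP => // def_j; case/eqP: ne; apply: val_inj => /=.
  apply/eqP; rewrite -(nth_uniq (enum_val a) _ _ (enum_uniq J)) -?cardE -?cIJ //.
  by rewrite def_j eJ nth_cat ltnn subnn.
congr (\det _); apply/matrixP => a b; rewrite !mxE D_gen -val_eqE /= eJ.
rewrite !nth_cat; case: ltngtP => // [lt|->].
  by rewrite -(subnSK lt).
by rewrite subnn /= eqxx.
Qed.

Lemma derivation_set_minor_dup (J : {set 'I_n}) :
  #|I| = #|J| -> j \in J -> m \in J -> m != j -> D (set_minor A I J) = 0.
Proof.
move=> cIJ jJ mJ ne; rewrite derivation_set_minor // seq_minor_dup ?mulr0 //.
  by rewrite -cardE cIJ (cardsD1 j J) jJ.
by rewrite mem_enum !inE ne.
Qed.

(** Sorting the new list takes [m] from the front to its place in the new set. Together with the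
    move of [j] to the front, the crossings cancel modulo 2 except for members of [J] between [j]
    and [m]. One of the two intervals is empty, so their union covers both orders. *)
Lemma derivation_set_minor_swap (J : {set 'I_n}) :
  #|I| = #|J| -> j \in J -> m \notin J ->
  D (set_minor A I J)
    = (-1) ^+ #|J :&: (open_itv j m :|: open_itv m j)|
        * set_minor A I ((m |: J) :\ j).
Proof.
move=> cIJ jJ mJ; rewrite derivation_set_minor //.
have ne : m != j by apply: contraNneq mJ => ->.
have mK : m \in (m |: J) :\ j by rewrite !inE ne eqxx.
have KD1 : ((m |: J) :\ j) :\ m = J :\ j.
  by apply/setP => q; rewrite !inE; case: eqP => [->|]; rewrite ?(negbTE mJ) ?andbF.
have cK : #|I| = #|(m |: J) :\ j|.
  by rewrite (cardsD1 m) mK KD1 cIJ (cardsD1 j J) jJ.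
rewrite (set_minor_head _ m) // KD1 mulrA -exprD; congr (_ * _).
rewrite -signr_odd -[RHS]signr_odd; congr (_ ^+ (_ : bool)).
have [lt_jm|lt_mj|/val_inj eq_jm] := ltngtP j m; last by rewrite eq_jm eqxx in ne.
  have <- : (#|[set q in J | (q < j)%N]| + #|J :&: (open_itv j m :|: open_itv m j)|
      = #|[set q in (m |: J) :\ j | (q < m)%N]|)%N.
    rewrite !card_sum_mem -big_split; apply: eq_bigr => q _ /=.
    rewrite !inE -!val_eqE /=; case: (q \in J); lia.
  by rewrite !oddD; case: (odd _); case: (odd _).
have -> : (#|[set q in J | (q < j)%N]| =
    #|J :&: (open_itv j m :|: open_itv m j)| +
      #|[set q in (m |: J) :\ j | (q < m)%N]|)%N => //.
rewrite !card_sum_mem -big_split; apply: eq_bigr => q _ /=.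
rewrite !inE -!val_eqE /=; case: (eqVneq q m) => [->|].
  by rewrite (negbTE mJ) /=; lia.
by rewrite -val_eqE /=; case: (q \in J); lia.
Qed.

Lemma derivation_set_minor_id (J : {set 'I_n}) : m = j ->
  #|I| = #|J| -> j \in J -> D (set_minor A I J) = set_minor A I J.
Proof.
by move=> eq_mj cIJ jJ; rewrite derivation_set_minor // eq_mj -set_minor_head.
Qed.

End Replacement.

End ColumnLists.

(** A term survives only if [j] is in [J], [m] is in [N], and neither replacement repeats a column:
    either [j = m] lies in both sets, or [j] is in [J :\: N] and [m] in [N :\: J]. The weight [w] is
    left free so that columns and rows are both covered. *)
Lemma sum_replacements (R : comNzRingType) (n : nat) (A : 'M[R]_n)
    (D : 'I_n -> 'I_n -> R -> R) (w : 'I_n -> 'I_n -> R)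
    (I J M N : {set 'I_n}) :
  (forall j m, {morph D j m : f g / f + g}) ->
  (forall j m f g, D j m (f * g) = D j m f * g + f * D j m g) ->
  (forall j m a b, D j m (A a b) = if b == j then A a m else 0) ->
  #|I| = #|J| -> #|M| = #|N| ->
  \sum_j \sum_m w j m * (D j m (set_minor A I J) * D m j (set_minor A M N))
    = (\sum_(j in J :&: N) w j j) * (set_minor A I J * set_minor A M N)
      + \sum_(j in J :\: N) \sum_(p in N :\: J)
          w j p * ((-1) ^+ #|symdiff J N :&: (open_itv j p :|: open_itv p j)|
            * (set_minor A I ((p |: J) :\ j) * set_minor A M ((j |: N) :\ p))).
Proof.
move=> D_add D_mul D_gen cIJ cMN.
rewrite mulr_suml [X in X + _]big_mkcond [X in _ + X]big_mkcond -big_split /=.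
apply: eq_bigr => j _; rewrite !inE.
have [jJ|jJ] := boolP (j \in J); last first.
  rewrite andbF addr0 big1 // => m _.
  by rewrite (derivation_set_minor0 _ _ _ _ (D j m) j m) // mul0r mulr0.
have [jN|jN] /= := boolP (j \in N).
  rewrite addr0 (bigD1 j) //= big1 ?addr0 => [|m ne].
    by rewrite !(derivation_set_minor_id _ _ _ _ (D j j) j j).
  have [mJ|mJ] := boolP (m \in J).
    by rewrite (derivation_set_minor_dup _ _ _ _ (D j m) j m) // mul0r mulr0.
  have [mN|mN] := boolP (m \in N).
    by rewrite (derivation_set_minor_dup _ _ _ _ (D m j) m j) 1?eq_sym // !mulr0.
  by rewrite (derivation_set_minor0 _ _ _ _ (D m j) m j) // !mulr0.
rewrite add0r [RHS]big_mkcond; apply: eq_bigr => m _; rewrite !inE.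
have [mN|mN] := boolP (m \in N); last first.
  by rewrite andbF (derivation_set_minor0 _ _ _ _ (D m j) m j) // !mulr0.
have [mJ|mJ] /= := boolP (m \in J).
  rewrite (derivation_set_minor_dup _ _ _ _ (D j m) j m) ?mul0r ?mulr0 //.
  by apply: contraNneq jN => <-.
rewrite (derivation_set_minor_swap _ _ _ _ (D j m) j m) //.
rewrite (derivation_set_minor_swap _ _ _ _ (D m j) m j) //.
set S := open_itv j m :|: open_itv m j; rewrite [open_itv m j :|: _]setUC -/S.
(* The two signs count [J] and [N] separately; common members are counted twice and drop out of the
   parity. *)
have signM : (-1) ^+ #|symdiff J N :&: S|
    = (-1) ^+ #|J :&: S| * (-1) ^+ #|N :&: S| :> R.
  rewrite -exprD -signr_odd -[RHS]signr_odd; congr (_ ^+ (_ : bool)).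
  have -> : (#|J :&: S| + #|N :&: S|
      = #|symdiff J N :&: S| + (#|J :&: N :&: S|).*2)%N.
    rewrite -addnn !card_sum_mem -!big_split; apply: eq_bigr => q _ /=.
    by rewrite !inE; case: (q \in J); case: (q \in N); case: (_ || _).
  by rewrite oddD odd_double addbF.
by rewrite signM; ring.
Qed.

(** * Transposition, exchanging the roles of rows and columns *)

(** The default in [set_minor] depends on the row; a fixed one makes the formula symmetric in rows
    and columns. *)
Lemma set_minor_nth (R : comNzRingType) (n : nat) (A : 'M[R]_n)
    (I J : {set 'I_n}) (x0 : 'I_n) : #|I| = #|J| ->
  set_minor A I J
    = \det (\matrix_(a < #|I|, b < #|I|)
              A (nth x0 (enum I) a) (nth x0 (enum J) b)).
Proof.
move=> cIJ; congr (\det _); apply/matrixP => a b; rewrite !mxE.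
rewrite (enum_val_nth x0); congr (A _ _); apply: set_nth_default.
by rewrite -cardE -cIJ.
Qed.

Lemma set_minor_tr (R : comNzRingType) (n : nat) (A : 'M[R]_n)
    (I J : {set 'I_n}) (x0 : 'I_n) : #|I| = #|J| ->
  set_minor A^T J I = set_minor A I J.
Proof.
move=> cIJ; rewrite !(set_minor_nth _ _ _ _ _ x0) // -cIJ -det_tr.
by congr (\det _); apply/matrixP => a b; rewrite !mxE.
Qed.

(** * The bracket in terms of column and row shifts *)

Section Shifts.
Variables (k : fieldType) (n : nat).
Local Notation x := (gen_mx k n).

Lemma mderiv_gen (a b i j : 'I_n) :
  (x a b)^`M(mxvec_index i j) = if (a == i) && (b == j) then 1 else 0 :> OMn k n.
Proof.
have ix_inj : injective (fun c : 'I_n * 'I_n => mxvec_index c.1 c.2).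
  by case=> [? ?] [? ?] /cast_ord_inj/enum_rank_inj.
rewrite mxE mderivX mnm1E (inj_eq ix_inj (a, b) (i, j)) xpair_eqE.
case: andP => [[/eqP-> /eqP->]|_]; last by rewrite scale0r.
rewrite scale1r -mpolyX0; congr 'X_[_]; apply/mnmP => q.
by rewrite !mnmE subnn.
Qed.

(** These are the classical polarization operators, here on columns and below on rows. *)
Definition col_shift (j m : 'I_n) (f : OMn k n) : OMn k n :=
  \sum_i f^`M(mxvec_index i j) * x i m.

Definition row_shift (i l : 'I_n) (f : OMn k n) : OMn k n :=
  \sum_j f^`M(mxvec_index i j) * x l j.

Lemma col_shiftD j m : {morph col_shift j m : f g / f + g}.
Proof.
move=> f g; rewrite /col_shift -big_split; apply: eq_bigr => i _.
by rewrite mderivD mulrDl.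
Qed.

Lemma row_shiftD i l : {morph row_shift i l : f g / f + g}.
Proof.
move=> f g; rewrite /row_shift -big_split; apply: eq_bigr => j _.
by rewrite mderivD mulrDl.
Qed.

Lemma col_shiftM j m f g :
  col_shift j m (f * g) = col_shift j m f * g + f * col_shift j m g.
Proof.
rewrite /col_shift mulr_suml mulr_sumr -big_split; apply: eq_bigr => i _ /=.
by rewrite mderivM; ring.
Qed.

Lemma row_shiftM i l f g :
  row_shift i l (f * g) = row_shift i l f * g + f * row_shift i l g.
Proof.
rewrite /row_shift mulr_suml mulr_sumr -big_split; apply: eq_bigr => j _ /=.
by rewrite mderivM; ring.
Qed.

Lemma col_shift_gen j m a b : col_shift j m (x a b) = if b == j then x a m else 0.
Proof.
rewrite /col_shift (bigD1 a) //= mderiv_gen eqxx /= big1 => [|i ne].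
  by rewrite addr0; case: ifP; rewrite ?mul1r ?mul0r.
by rewrite mderiv_gen eq_sym (negbTE ne) mul0r.
Qed.

(** Phrased on the transpose, so that a row shift satisfies the column hypothesis of
    [sum_replacements] for the matrix [x^T]. *)
Lemma row_shift_gen i l a b :
  row_shift i l (x^T a b) = if b == i then x^T a l else 0.
Proof.
rewrite ![x^T _ _]mxE /row_shift (bigD1 a) //= mderiv_gen eqxx andbT.
rewrite big1 => [|j ne].
  by rewrite addr0; case: ifP; rewrite ?mul1r ?mul0r.
by rewrite mderiv_gen [a == j]eq_sym (negbTE ne) andbF mul0r.
Qed.

Lemma standard_bracket_shifts (f g : OMn k n) :
  standard_bracket f g
    = \sum_(j < n) \sum_(m < n) ((j == m)%:R + 2%:R * (j < m)%N%:R)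
         * (col_shift j m f * col_shift m j g)
      - \sum_(i < n) \sum_(l < n) ((i == l)%:R + 2%:R * (l < i)%N%:R)
         * (row_shift i l f * row_shift l i g).
Proof.
(* Column sums and row sums both unfold to this quadruple sum over the same products, so the
   identity can be checked weight by weight. *)
pose F (w : 'I_n -> 'I_n -> 'I_n -> 'I_n -> OMn k n) :=
  \sum_i \sum_j \sum_l \sum_m
    w i j l m * (f^`M(mxvec_index i j) * g^`M(mxvec_index l m) * x i m * x l j).
have colE (w : 'I_n -> 'I_n -> OMn k n) :
    \sum_j \sum_m w j m * (col_shift j m f * col_shift m j g)
      = F (fun i j l m => w j m).
  rewrite /F [RHS]exchange_big /=; apply: eq_bigr => j _.
  under [RHS]eq_bigr => i _ do rewrite exchange_big /=.
  rewrite [RHS]exchange_big /=; apply: eq_bigr => m _.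
  rewrite /col_shift big_distrlr /= mulr_sumr; apply: eq_bigr => i _.
  by rewrite mulr_sumr; apply: eq_bigr => l _; ring.
have rowE (w : 'I_n -> 'I_n -> OMn k n) :
    \sum_i \sum_l w i l * (row_shift i l f * row_shift l i g)
      = F (fun i j l m => w i l).
  rewrite /F; apply: eq_bigr => i _.
  rewrite [RHS]exchange_big /=; apply: eq_bigr => l _.
  rewrite /row_shift big_distrlr /= mulr_sumr; apply: eq_bigr => j _.
  by rewrite mulr_sumr; apply: eq_bigr => m _; ring.
rewrite colE rowE /F -sumrB /standard_bracket -(pair_bigA _ (fun i j =>
  \sum_b f^`M(mxvec_index i j) * g^`M(mxvec_index b.1 b.2) *
     (((i < b.1)%N%:R - (b.1 < i)%N%:R + ((j < b.2)%N%:R - (b.2 < j)%N%:R))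
       * x i b.2 * x b.1 j))) /=.
apply: eq_bigr => i _; rewrite -sumrB; apply: eq_bigr => j _.
rewrite -(pair_bigA _ (fun l m =>
  f^`M(mxvec_index i j) * g^`M(mxvec_index l m) *
     (((i < l)%N%:R - (l < i)%N%:R + ((j < m)%N%:R - (m < j)%N%:R))
       * x i m * x l j))) /=.
rewrite -sumrB; apply: eq_bigr => l _; rewrite -sumrB; apply: eq_bigr => m _.
rewrite -mulrBl -!val_eqE /=.
(* By trichotomy the column weight is [1 + sg j m] and the row weight is [1 - sg i l]; their
   difference is the coefficient of the bracket. *)
by case: (ltngtP j m) => _; case: (ltngtP i l) => _ /=; ring.
Qed.

End Shifts.

(** * Assembling the bracket of two minors *)

Theorem theorem7p3 (k : fieldType) (n : nat) (n_gt0 : (0 < n)%N)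
    (br : OMn k n -> OMn k n -> OMn k n) (br_std : is_standard_poisson br)
    (I J M N : {set 'I_n}) (cardIJ : #|I| = #|J|) (cardMN : #|M| = #|N|) :
  br (minor k I J) (minor k M N)
    = (#|J :&: N|%:R - #|I :&: M|%:R) * (minor k I J * minor k M N)
      + 2%:R * (\sum_(j in J :\: N) \sum_(p in N :\: J | (j < p)%N)
          (-1) ^+ #|symdiff J N :&: open_itv j p|
            * (minor k I ((p |: J) :\ j) * minor k M ((j |: N) :\ p)))
      - 2%:R * (\sum_(i in I :\: M) \sum_(m in M :\: I | (m < i)%N)
          (-1) ^+ #|symdiff I M :&: open_itv m i|
            * (minor k ((m |: I) :\ i) J * minor k ((i |: M) :\ m) N)).
Proof.
have x0 := Ordinal n_gt0.
have open_itv0 (a b : 'I_n) : (a < b)%N -> open_itv b a = set0.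
  by move=> lt; apply/setP => q; rewrite !inE; apply/negP => /andP[]; lia.
(* Exchanging an index keeps the cardinality, as needed to transpose the new minors back. *)
have card_swap (A B : {set 'I_n}) a b :
    a \in A :\: B -> b \in B :\: A -> #|(b |: A) :\ a| = #|A|.
  rewrite !inE => /andP[aB aA] /andP[bA bB].
  have ba : b != a by apply: contraNneq bA => ->.
  have := cardsD1 a (b |: A); rewrite cardsU1 !inE aA bA orbT /=; lia.
(* On the diagonal the weight is 1, so these terms count the common indices. *)
have diag (A B : {set 'I_n}) (lt : rel 'I_n) : irreflexive lt ->
    \sum_(j in A :&: B) ((j == j)%:R + 2%:R * (lt j j)%:R)
      = #|A :&: B|%:R :> OMn k n.
  move=> lt_irr; rewrite -sumr_const; apply: eq_bigr => j _.
  by rewrite eqxx lt_irr mulr0 addr0.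
(* Uniqueness replaces [br] by the explicit bracket built from partial derivatives. *)
rewrite (standard_poisson_unique br_std (standard_bracketP k n)).
rewrite standard_bracket_shifts /minor.
rewrite (sum_replacements _ _ _ _
  (fun j m : 'I_n => (j == m)%:R + 2%:R * (j < m)%N%:R)
  _ _ _ _ (@col_shiftD k n) (@col_shiftM k n) (@col_shift_gen k n)) //.
rewrite (diag _ _ (fun j m => (j < m)%N)) => [|j]; last exact: ltnn.
(* The row sum is a column sum for the transposed generic matrix, with [I] and [M] as the column
   sets. *)
have rowE : \sum_(i < n) \sum_(l < n)
    ((i == l)%:R + 2%:R * (l < i)%N%:R)
      * (row_shift k n i l (set_minor (gen_mx k n) I J)
         * row_shift k n l i (set_minor (gen_mx k n) M N))
    = #|I :&: M|%:R * (minor k I J * minor k M N)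
      + 2%:R * (\sum_(i in I :\: M) \sum_(m in M :\: I | (m < i)%N)
          (-1) ^+ #|symdiff I M :&: open_itv m i|
            * (minor k ((m |: I) :\ i) J * minor k ((i |: M) :\ m) N)).
  rewrite -(set_minor_tr _ _ _ I J x0) // -(set_minor_tr _ _ _ M N x0) //.
  rewrite (sum_replacements _ _ _ _
    (fun i l : 'I_n => (i == l)%:R + 2%:R * (l < i)%N%:R)
    _ _ _ _ (@row_shiftD k n) (@row_shiftM k n) (@row_shift_gen k n)) //.
  rewrite (diag _ _ (fun i l => (l < i)%N)) => [|i]; last exact: ltnn.
  rewrite !(set_minor_tr _ _ _ _ _ x0) // -/(minor k I J) -/(minor k M N).
  congr (_ + _); rewrite mulr_sumr; apply: eq_bigr => i iI.
  rewrite mulr_sumr [RHS]big_mkcondr; apply: eq_bigr => m mM.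
  have cI : #|(m |: I) :\ i| = #|J| by rewrite (card_swap I M).
  have cM : #|(i |: M) :\ m| = #|N| by rewrite (card_swap M I).
  rewrite !(set_minor_tr _ _ _ _ _ x0) // -!val_eqE /=.
  (* The weight is 2 for [m < i] and 0 for [i < m]; equality is impossible, since [i] is not in
     [M]. *)
  have [lt|_|/val_inj eq_im] := ltngtP m i.
  - by rewrite (open_itv0 _ _ lt) set0U add0r mulr1.
  - by rewrite mulr0 addr0 mul0r.
  - by move: iI mM; rewrite eq_im !inE => /andP[_ ->].
rewrite rowE /minor.
have -> : \sum_(j in J :\: N) \sum_(p in N :\: J)
     ((j == p)%:R + 2%:R * (j < p)%N%:R)
       * ((-1) ^+ #|symdiff J N :&: (open_itv j p :|: open_itv p j)|
         * (set_minor (gen_mx k n) I ((p |: J) :\ j)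
            * set_minor (gen_mx k n) M ((j |: N) :\ p)))
    = 2%:R * (\sum_(j in J :\: N) \sum_(p in N :\: J | (j < p)%N)
          (-1) ^+ #|symdiff J N :&: open_itv j p|
            * (minor k I ((p |: J) :\ j) * minor k M ((j |: N) :\ p))).
  rewrite mulr_sumr; apply: eq_bigr => j jJ.
  rewrite mulr_sumr [RHS]big_mkcondr; apply: eq_bigr => p pN.
  rewrite -!val_eqE /=.
  have [lt|_|/val_inj eq_jp] := ltngtP j p.
  - by rewrite (open_itv0 _ _ lt) setU0 add0r mulr1.
  - by rewrite mulr0 addr0 mul0r.
  - by move: jJ pN; rewrite eq_jp !inE => /andP[_ ->].
by rewrite /minor; ring.
Qed.
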